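(* Let $R$ be an associative ring with identity and $p$ a prime number. The map $\theta_p\colon H_1(R)\to HC_1(R/pR)$ determined by $$\Bigl[\sum_{i\in I_n}\alpha_i\otimes\beta_i\Bigr]\mapsto\Bigl[\sum_{i\in I_n}(\alpha_i\beta_i)^{p-1}\alpha_i\otimes\beta_i+\sum_{\gamma\in\Gamma_n}\sum_{t=1}^{p-1}\bigl(t\,(\sigma^t\gamma)(\alpha,\beta)-t\,(\sigma^t\gamma)(\beta,\alpha)\bigr)\Bigr]$$ is a well-defined homomorphism.
   Context: $\otimes=\otimes_{\mathbb Z}$. Put $b(r_1\otimes r_2)=r_1r_2-r_2r_1$ and $b(r_1\otimes r_2\otimes r_3)=r_1r_2\otimes r_3-r_1\otimes r_2r_3+r_3r_1\otimes r_2$. Then $H_1(R)=\ker(b\colon R\otimes R\to R)/\mathrm{im}(b\colon R\otimes R\otimes R\to R\otimes R)$, and $HC_1(R)=\ker(b\colon R\otimes R\to R)/\bigl(\mathrm{im}(b\colon R\otimes R\otimes R\to R\otimes R)+\{r\otimes s+s\otimes r\}\bigr)$, where the last set stands for the subgroup generated by all $r\otimes s+s\otimes r$. Brackets denote classes. $I_n=\{1,\dots,n\}$. A permutation $\tau\in S_p$ acts on $I_n^p$ by $\tau(i_1,\dots,i_p)=(i_{\tau(1)},\dots,i_{\tau(p)})$. $\sigma=(1\,2\cdots p)^{-1}$, $\Delta_n=\{\gamma\in I_n^p\mid\sigma\gamma=\gamma\}$, and $\Gamma_n$ is a set of representatives of the $\sigma$-orbits on $I_n^p-\Delta_n$. For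 maps $\alpha,\beta\colon I_n\to R$ and $\gamma=(i_1,\dots,i_p)\in I_n^p$, $\gamma(\alpha,\beta)=\alpha_{i_1}\beta_{i_1}\alpha_{i_2}\beta_{i_2}\cdots\alpha_{i_{p-1}}\beta_{i_{p-1}}\otimes\alpha_{i_p}\beta_{i_p}$. Elements of $R\otimes R$ are reduced modulo $p$ to define classes in $HC_1(R/pR)$. *)

(* Defs.v *)
From HB Require Import structures.
From mathcomp Require Import all_boot all_order all_fingroup all_algebra.
From mathcomp Require Import generic_quotient boolp.
From mathcomp.multinomials Require Import freeg.

Set Implicit Arguments.
Unset Strict Implicit.
Unset Printing Implicit Defensive.

Import GRing.Theory.
Local Open Scope ring_scope.
Local Open Scope quotient_scope.

(* Rings are [pzRingType]s: the zero ring is allowed, because R / pR is the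
   zero ring as soon as p is invertible in R. *)

Section GeneratedSubgroup.
Variables (V : zmodType) (S : V -> Prop).

Inductive in_span : V -> Prop :=
| span_gen x : S x -> in_span x
| span_0 : in_span 0
| span_B x y : in_span x -> in_span y -> in_span (x - y).

Definition spanZ : {pred V} := fun x => `[< in_span x >].

Fact spanZ_closed : zmod_closed spanZ.
Proof.
split=> [|x y /asboolP hx /asboolP hy]; apply/asboolP; first exact: span_0.
exact: span_B.
Qed.
HB.instance Definition _ := GRing.isZmodClosed.Build V spanZ spanZ_closed.

(* The quotient of V by the subgroup generated by S. *)
Definition zquot := Quotient.quot spanZ.
HB.instance Definition _ := GRing.Zmodule.on zquot.

Definition zclass (x : V) : zquot := \pi_zquot x.

Fact zclass_is_zmod_morphism : zmod_morphism zclass.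
Proof. exact: (@raddfB V (Quotient.quot spanZ) \pi). Qed.
HB.instance Definition _ :=
  GRing.isZmodMorphism.Build V zquot zclass zclass_is_zmod_morphism.

Lemma zclass_eq0 x : zclass x = 0 <-> in_span x.
Proof.
rewrite /zclass -[0](raddf0 (\pi_(Quotient.quot spanZ) : {additive _ -> _})).
split=> [/eqP|h]; last apply/eqP; rewrite -(Quotient.idealrBE spanZ) subr0.
  by move/asboolP.
exact/asboolP.
Qed.

End GeneratedSubgroup.

Section Kernel.
Variables (V W : zmodType) (f : {additive V -> W}).

Definition ker_pred : {pred V} := fun x => f x == 0.

Fact ker_pred_closed : zmod_closed ker_pred.
Proof.
split=> [|x y]; rewrite !unfold_in ?raddf0 // raddfB => /eqP-> /eqP->.
by rewrite subr0.
Qed.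
HB.instance Definition _ := GRing.isZmodClosed.Build V ker_pred ker_pred_closed.

Record kernel := Kernel { kerval : V; _ : kerval \in ker_pred }.
HB.instance Definition _ := [isSub for kerval].
HB.instance Definition _ := [Choice of kernel by <:].
HB.instance Definition _ := [SubChoice_isSubZmodule of kernel by <:].

End Kernel.

Section TensorProduct.
Variables A B : zmodType.

Inductive tensor_rel : {freeg (A * B)} -> Prop :=
| tensor_relDl a a' b :
    tensor_rel (<< (a + a', b) >> - << (a, b) >> - << (a', b) >>)
| tensor_relDr a b b' :
    tensor_rel (<< (a, b + b') >> - << (a, b) >> - << (a, b') >>).

Definition tensor := zquot tensor_rel.
HB.instance Definition _ := GRing.Zmodule.on tensor.

Definition tens (a : A) (b : B) : tensor := zclass tensor_rel << (a, b) >>.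

Definition biadditive (V : zmodType) (f : A -> B -> V) :=
  (forall b, {morph f^~ b : a a' / a + a'}) /\
  (forall a, {morph f a : b b' / b + b'}).

Lemma tens_biadditive : biadditive tens.
Proof.
split=> [b a a'|a b b']; apply/eqP; rewrite -subr_eq0 opprD addrA;
  apply/eqP; rewrite /tens -2!(raddfB (zclass tensor_rel));
  apply/zclass_eq0/span_gen.
- exact: tensor_relDl.
- exact: tensor_relDr.
Qed.

Lemma tensor_ind (P : tensor -> Prop) :
  P 0 -> (forall x y, P x -> P y -> P (x - y)) ->
  (forall a b, P (tens a b)) -> forall x, P x.
Proof.
move=> P0 PB Pt x; rewrite -[x]reprK -[repr x]freeg_sumE.
have PN y : P y -> P (- y) by move=> ?; rewrite -sub0r; apply: PB.
have PD y z : P y -> P z -> P (y + z).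
  by move=> ? /PN ?; rewrite -[z]opprK; apply: PB.
have -> : \pi_tensor =1 zclass tensor_rel by [].
rewrite raddf_sum; elim/big_ind: _ => // -[a b] _.
rewrite -[coeff _ _]intz -freegU_mulz raddfMz /=.
have Pn n : P (tens a b *+ n).
  by elim: n => [|n IHn]; rewrite ?mulr0n // mulrS; apply: PD.
by case: (coeff _ _) => n; [apply: Pn | apply/PN/Pn].
Qed.

(* The additive map sending [tens a b] to [f a b]. *)
Definition tensor_lift (V : zmodType) (f : A -> B -> V) (x : tensor) : V :=
  fglift (fun ab => f ab.1 ab.2 : zmodule V) (repr x).

Section Lift.
Variables (V : zmodType) (f : A -> B -> V) (f_bi : biadditive f).
Let F : {freeg (A * B)} -> V := fglift (fun ab => f ab.1 ab.2 : zmodule V).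

Let FB x y : F (x - y) = F x - F y.
Proof. exact: (@lift_is_additive int _ (zmodule V)). Qed.

Let F1 a b : F << (a, b) >> = f a b.
Proof. by rewrite /F liftU scale1r. Qed.

Let F_span x : in_span tensor_rel x -> F x = 0.
Proof.
elim=> [{}x []|| {}x y _ hx _ hy]; last by rewrite FB hx hy subrr.
- by move=> a a' b; rewrite !FB !F1 f_bi.1 -addrA -opprD subrr.
- by move=> a b b'; rewrite !FB !F1 f_bi.2 -addrA -opprD subrr.
- by rewrite -(subrr 0) FB subrr.
Qed.

Let lift_class x : tensor_lift f (zclass tensor_rel x) = F x.
Proof.
apply/eqP; rewrite -subr_eq0 -FB; apply/eqP/F_span/zclass_eq0.
by rewrite raddfB /= {1}/zclass reprK subrr.
Qed.

Lemma tensor_lift_zmod_morphism : zmod_morphism (tensor_lift f).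
Proof.
move=> x y; rewrite -[x]reprK -[y]reprK.
have e z : \pi_tensor z = zclass tensor_rel z by [].
by rewrite !e -raddfB !lift_class FB.
Qed.

Lemma tensor_liftE a b : tensor_lift f (tens a b) = f a b.
Proof. by rewrite lift_class F1. Qed.
End Lift.

End TensorProduct.

Section TensorMap.
Variables (A B A' B' : zmodType).
Variables (f : {additive A -> A'}) (g : {additive B -> B'}).

Definition tensor_map : tensor A B -> tensor A' B' :=
  tensor_lift (fun a b => tens (f a) (g b)).

Fact tensor_map_biadditive : biadditive (fun a b => tens (f a) (g b)).
Proof.
split=> [b a a'|a b b'] /=; rewrite raddfD.
- exact: (tens_biadditive A' B').1.
- exact: (tens_biadditive A' B').2.
Qed.
HB.instance Definition _ := GRing.isZmodMorphism.Build _ _ tensor_map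
  (tensor_lift_zmod_morphism tensor_map_biadditive).

Lemma tensor_mapE a b : tensor_map (tens a b) = tens (f a) (g b).
Proof. exact/tensor_liftE/tensor_map_biadditive. Qed.
End TensorMap.

Section Hochschild.
Variable R : pzRingType.

Definition b2 : tensor R R -> R :=
  tensor_lift (fun r1 r2 : R => r1 * r2 - r2 * r1).

Fact b2_biadditive : biadditive (fun r1 r2 : R => r1 * r2 - r2 * r1).
Proof.
by split=> [b a a'|a b b'] /=; rewrite mulrDl mulrDr opprD addrACA.
Qed.
HB.instance Definition _ := GRing.isZmodMorphism.Build _ _ b2
  (tensor_lift_zmod_morphism b2_biadditive).

Lemma b2E r1 r2 : b2 (tens r1 r2) = r1 * r2 - r2 * r1.
Proof. exact/tensor_liftE/b2_biadditive. Qed.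

Definition b3_last (r3 r1 r2 : R) : tensor R R :=
  tens (r1 * r2) r3 - tens r1 (r2 * r3) + tens (r3 * r1) r2.

Definition b3 : tensor (tensor R R) R -> tensor R R :=
  tensor_lift (fun x r3 => tensor_lift (b3_last r3) x).

Let tDl (b a a' : R) : tens (a + a') b = tens a b + tens a' b.
Proof. exact: (tens_biadditive R R).1. Qed.
Let tDr (a b b' : R) : tens a (b + b') = tens a b + tens a b'.
Proof. exact: (tens_biadditive R R).2. Qed.

Let shuffle (x x' y y' z z' : tensor R R) :
  (x + x') - (y + y') + (z + z') = (x - y + z) + (x' - y' + z').
Proof. by rewrite opprD (addrACA x) [LHS]addrACA. Qed.

Fact b3_last_biadditive r3 : biadditive (b3_last r3).
Proof.
by split=> [b a a'|a b b']; rewrite /b3_last !(mulrDl, mulrDr, tDl, tDr) shuffle.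
Qed.

Fact b3_biadditive : biadditive (fun x r3 => tensor_lift (b3_last r3) x).
Proof.
have lB r3 := tensor_lift_zmod_morphism (b3_last_biadditive r3).
have l0 r3 : tensor_lift (b3_last r3) 0 = 0 by have := lB r3 0 0; rewrite !subrr.
have lN r3 y : tensor_lift (b3_last r3) (- y) = - tensor_lift (b3_last r3) y.
  by rewrite -[- y]sub0r lB l0 sub0r.
split=> [r3 x y|x r3 r3'].
  by rewrite -{1}[y]opprK lB lN opprK.
rewrite /tensor_lift; set D := repr x.
have e (V : lmodType int) (f : R * R -> V) :
    fglift f D = \sum_(z <- repr D) z.1 *: f z.2.
  by rewrite -{1}[D]freeg_repr fglift_Freeg.
rewrite !e -big_split /=; apply: eq_bigr => z _.
apply: etrans (@scalerDr _ (zmodule (tensor R R)) _ _ _); congr (_ *: _).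
by rewrite /b3_last !(mulrDl, mulrDr, tDl, tDr) shuffle.
Qed.
HB.instance Definition _ := GRing.isZmodMorphism.Build _ _ b3
  (tensor_lift_zmod_morphism b3_biadditive).

Lemma b3E r1 r2 r3 : b3 (tens (tens r1 r2) r3) =
  tens (r1 * r2) r3 - tens r1 (r2 * r3) + tens (r3 * r1) r2.
Proof.
rewrite [LHS](tensor_liftE b3_biadditive).
exact: (tensor_liftE (b3_last_biadditive r3)).
Qed.

Definition im_b3 (x : tensor R R) : Prop := exists y, x = b3 y.

Definition sym_tensor (x : tensor R R) : Prop :=
  exists r s, x = tens r s + tens s r.

(* Both [im_b3] and [sym_tensor] are contained in ker b2 (see [im_b3_ker] and
   [sym_tensor_ker]), so restricting the generators to [kernel b2] loses none
   of them. *)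
Definition H1 := zquot (fun x : kernel b2 => im_b3 (val x)).
HB.instance Definition _ := GRing.Zmodule.on H1.

Definition HC1 :=
  zquot (fun x : kernel b2 => im_b3 (val x) \/ sym_tensor (val x)).
HB.instance Definition _ := GRing.Zmodule.on HC1.

Definition H1_class (x : kernel b2) : H1 := zclass _ x.
Definition HC1_class (x : kernel b2) : HC1 := zclass _ x.

Lemma im_b3_ker x : im_b3 x -> b2 x = 0.
Proof.
case=> y ->; elim/tensor_ind: y => [|y z hy hz|x0 r3].
- by rewrite !raddf0.
- by rewrite (raddfB b3) (raddfB b2) /= hy hz subrr.
elim/tensor_ind: x0 => [|y z hy hz|r1 r2].
- have -> : tens (0 : tensor R R) r3 = 0; last by rewrite !raddf0.
  have := (tens_biadditive (tensor R R) R).1 r3 0 0.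
  by rewrite addr0 => /eqP; rewrite eq_sym addrC -subr_eq0 addrK => /eqP.
- have -> : tens (y - z) r3 = tens y r3 - tens z r3.
    apply/eqP; rewrite eq_sym subr_eq -(tens_biadditive (tensor R R) R).1.
    by rewrite subrK.
  by rewrite (raddfB b3) (raddfB b2) /= hy hz subrr.
rewrite b3E (raddfD b2) (raddfB b2) /= !b2E !mulrA opprB.
by rewrite [X in X + _ = _]addrC !addrA !subrK subrr.
Qed.

Lemma sym_tensor_ker x : sym_tensor x -> b2 x = 0.
Proof. by case=> r [s ->]; rewrite raddfD /= !b2E addrA subrK subrr. Qed.

End Hochschild.

Section ReductionModP.
Variables (R : pzRingType) (p : nat).

Definition p_multiple : {pred R} := fun x => `[< exists y, x = y *+ p >].

Fact p_multiple_closed : zmod_closed p_multiple.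
Proof.
split=> [|x y /asboolP[x' ->] /asboolP[y' ->]]; apply/asboolP.
  by exists 0; rewrite mul0rn.
by exists (x' - y'); rewrite mulrnBl.
Qed.
HB.instance Definition _ :=
  GRing.isZmodClosed.Build R p_multiple p_multiple_closed.

Definition quot_p := Quotient.quot p_multiple.
HB.instance Definition _ := GRing.Zmodule.on quot_p.

Definition red_p (x : R) : quot_p := \pi_quot_p x.

Fact red_p_is_zmod_morphism : zmod_morphism red_p.
Proof. exact: (@raddfB R (Quotient.quot p_multiple) \pi). Qed.
HB.instance Definition _ :=
  GRing.isZmodMorphism.Build R quot_p red_p red_p_is_zmod_morphism.

Lemma red_p_eq x y : red_p x = red_p y <-> exists z, x - y = z *+ p.
Proof.
split=> [/eqP|h]; last apply/eqP; rewrite -(Quotient.idealrBE p_multiple).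
  by move/asboolP.
exact/asboolP.
Qed.

Definition quot_p_mul (x y : quot_p) : quot_p := red_p (repr x * repr y).

Fact red_pM x y : red_p (x * y) = quot_p_mul (red_p x) (red_p y).
Proof.
have hx : red_p (repr (red_p x)) = red_p x by rewrite {1}/red_p reprK.
have hy : red_p (repr (red_p y)) = red_p y by rewrite {1}/red_p reprK.
move: hx hy => /red_p_eq[u hu] /red_p_eq[v hv]; apply/red_p_eq.
exists (- (u * repr (red_p y) + x * v)).
rewrite mulNrn mulrnDl -mulrnAl -mulrnAr -hu -hv mulrBl mulrBr.
by rewrite addrA subrK opprB.
Qed.

Let red_surj (P : quot_p -> Prop) : (forall x, P (red_p x)) -> forall x, P x.
Proof. by move=> h x; rewrite -[x]reprK; apply: h. Qed.

Fact quot_p_mulA : associative quot_p_mul.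
Proof.
elim/red_surj=> x; elim/red_surj=> y; elim/red_surj=> z.
by rewrite -!red_pM mulrA.
Qed.
Fact quot_p_mul1l : left_id (red_p 1) quot_p_mul.
Proof. by elim/red_surj=> x; rewrite -red_pM mul1r. Qed.
Fact quot_p_mul1r : right_id (red_p 1) quot_p_mul.
Proof. by elim/red_surj=> x; rewrite -red_pM mulr1. Qed.
Fact quot_p_mulDl : left_distributive quot_p_mul +%R.
Proof.
elim/red_surj=> x; elim/red_surj=> y; elim/red_surj=> z.
by rewrite -raddfD -!red_pM mulrDl raddfD.
Qed.
Fact quot_p_mulDr : right_distributive quot_p_mul +%R.
Proof.
elim/red_surj=> x; elim/red_surj=> y; elim/red_surj=> z.
by rewrite -raddfD -!red_pM mulrDr raddfD.
Qed.

HB.instance Definition _ := GRing.Zmodule_isPzRing.Build quot_p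
  quot_p_mulA quot_p_mul1l quot_p_mul1r quot_p_mulDl quot_p_mulDr.

Fact red_p_is_monoid_morphism : monoid_morphism red_p.
Proof. by split=> // x y; rewrite red_pM. Qed.
HB.instance Definition _ :=
  GRing.isMonoidMorphism.Build R quot_p red_p red_p_is_monoid_morphism.

Definition red_tensor : tensor R R -> tensor quot_p quot_p :=
  tensor_map red_p red_p.
HB.instance Definition _ := GRing.Additive.on red_tensor.

End ReductionModP.

(* Indices start at 0: I_n is ['I_n] and S_p acts on positions in ['I_p]. *)
Section CyclicWords.
Variables (p n : nat).

Definition perm_act (tau : 'S_p) (g : p.-tuple 'I_n) : p.-tuple 'I_n :=
  [tuple tnth g (tau k) | k < p].

Definition sigma : 'S_p := (perm (@ordS_inj p))^-1%g.

Definition Delta : {set p.-tuple 'I_n} := [set g | perm_act sigma g == g].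

Definition sigma_reps (Gamma : {set p.-tuple 'I_n}) : bool :=
  is_transversal Gamma
    (equivalence_partition (fconnect (perm_act sigma)) (~: Delta)) (~: Delta).

Variables (R : pzRingType) (alpha beta : 'I_n -> R).

(* For p > 0, [take p.-1] leaves out exactly the last letter. *)
Definition word_tensor (g : p.-tuple 'I_n) : tensor R R :=
  let w := [seq alpha i * beta i | i <- g] in
  tens (\prod_(x <- take p.-1 w) x) (last 1 w).

End CyclicWords.

Definition theta_expr (R : pzRingType) (p n : nat) (alpha beta : 'I_n -> R)
    (Gamma : {set p.-tuple 'I_n}) : tensor R R :=
  \sum_i tens ((alpha i * beta i) ^+ p.-1 * alpha i) (beta i) +
  \sum_(g in Gamma) \sum_(1 <= t < p)
    (word_tensor alpha beta (perm_act (sigma p ^+ t)%g g) *+ t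
     - word_tensor beta alpha (perm_act (sigma p ^+ t)%g g) *+ t).

(* [theta] is given by the formula, for every presentation of a cycle as a sum
   of pure tensors and every choice of representatives; in particular the
   reduction of [theta_expr] modulo p is required to be a cycle. *)
Definition given_by_theta_formula (R : pzRingType) (p : nat)
    (theta : H1 R -> HC1 (quot_p R p)) : Prop :=
  forall (n : nat) (alpha beta : 'I_n -> R) (Gamma : {set p.-tuple 'I_n})
         (z : kernel (@b2 R)),
    val z = \sum_i tens (alpha i) (beta i) ->
    sigma_reps Gamma ->
    exists2 w : kernel (@b2 (quot_p R p)),
      val w = red_tensor p (theta_expr alpha beta Gamma) &
      theta (H1_class z) = HC1_class w.

(* Main.v *)
(* Let T be the quotient of S (x) S, S = R / pR, by im b and all
   r (x) s + s (x) r; writing a db for the class of a (x) b, it consists of the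
   noncommutative 1-forms of S modulo commutators and exact forms, and HC_1(S)
   is the kernel of b on T. Give every word of length p that is moved by rotation
   a weight in Z/p that increases by 1 under rotation; as the sum of
   x_1 ... x_{p-1} dx_p over an orbit is d(x_1 ... x_p) = 0, weighted sums of
   words do not depend on the choice of the weight. The weighted sum c(x, y) over
   the words in x and y is a symmetric 2-cocycle, and
   (a, b) |-> (ab, ba, (ab)^{p-1} a db) is biadditive into the extension of
   S x S by T with cocycle c(x, x') - c(y, y'), by summation by parts along the
   orbits. The sum of the images of the pairs (alpha_i, beta_i) has the
   expression defining theta_p as its T-component, so this expression only
   depends on the tensor. On cycles the two cocycle terms cancel, whence
   additivity, and on im b it vanishes by the Leibniz rule. *)
Require Import Defs.
From HB Require Import structures.
From mathcomp Require Import all_boot all_order all_fingroup all_algebra.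
From mathcomp Require Import fingraph generic_quotient boolp zify.

Set Implicit Arguments.
Unset Strict Implicit.
Unset Printing Implicit Defensive.

Import GRing.Theory.
Local Open Scope ring_scope.

(** * Orbits of a map of prime order and sums weighted along them *)

Section PrimeOrbits.
Variables (X : finType) (s : X -> X) (p : nat).
Hypotheses (p_pr : prime p) (s_p : forall x, iter p s x = x).

Lemma prime_iter_inj : injective s.
Proof.
move=> x y sxy; rewrite -[x]s_p -[y]s_p.
by case: p p_pr => // n _; rewrite !iterSr sxy.
Qed.
Let s_inj := prime_iter_inj.

(** The orbit length divides [p], because [s] iterated [p %% order s x] times still fixes [x];
    length 1 would make [x] a fixed point. *)
Lemma prime_order x : s x != x -> order s x = p.
Proof.
move=> sx; have dvd : (order s x %| p)%N.
  have ltr : (p %% order s x < order s x)%N by rewrite ltn_mod order_gt0.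
  have itr : iter (p %% order s x) s x = x.
    rewrite -[RHS](s_p x) {2}(divn_eq p (order s x)) addnC iterD.
    congr iter; elim: (p %/ _)%N => //= k IH.
    by rewrite mulSn iterD -IH iter_order.
  by rewrite /dvdn -[X in X == _](findex_iter ltr) itr findex0.
move/primeP: p_pr => [_ /(_ _ dvd)] /orP[/eqP o1|/eqP //].
by have := iter_order s_inj x; rewrite o1 /= => /eqP; rewrite (negPf sx).
Qed.

(** One concrete weight, counted from the canonical root of the orbit. Weights are meant in Z/p but
    are kept as natural numbers compared modulo [p], so that they can serve as multiplicities in
    [*+]. *)
Definition weight x := findex s (froot s x) x.

Lemma weightS x : s x != x -> weight (s x) = (weight x).+1 %[mod p].
Proof.
move=> sx; rewrite /weight.
have symf : connect_sym (frel s) := fconnect_sym s_inj.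
have -> : froot s (s x) = froot s x.
  by apply/(rootP symf); rewrite symf fconnect1.
set r := froot s x; have rx : fconnect s r x by rewrite symf connect_root.
have ord : order s r = p.
  apply: prime_order; apply: contra sx => /eqP sr.
  by rewrite -(iter_findex rx) iter_fix // sr.
have ltx : (findex s r x < p)%N by rewrite -ord findex_max.
(* At the last point of the orbit the weight wraps around from [p - 1] to 0. *)
have := ltx; rewrite leq_eqVlt => /orP[/eqP e|lt].
  rewrite e modnn -[X in s X](iter_findex rx) -iterS e s_p findex0.
  by rewrite mod0n.
by rewrite -[X in s X](iter_findex rx) -iterS findex_iter // ord.
Qed.

Section Weighted.
Variables (T : zmodType) (T_p : forall t : T, t *+ p = 0).
Variables (N : pred X) (Ns : forall x, N (s x) = N x).
Hypothesis N_free : forall x, N x -> s x != x.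

Lemma mulrn_eqmod (t : T) m n : m = n %[mod p] -> t *+ m = t *+ n.
Proof.
move=> e; rewrite (divn_eq m p) (divn_eq n p) e !mulrnDr.
by rewrite !mulrnA -!(mulrnAC _ p) !T_p !mul0rn.
Qed.

Definition is_weight (w : X -> nat) :=
  forall x, N x -> w (s x) = (w x).+1 %[mod p].

Lemma weight_is_weight : is_weight weight.
Proof. by move=> x /N_free; apply: weightS. Qed.

(** Transversals of the orbits inside [N]; this covers both the canonical roots and the sets of
    representatives Gamma_n. *)
Definition is_root_set (G : pred X) :=
  [/\ forall g, G g -> N g, forall x, N x -> exists2 g, G g & fconnect s g x
    & forall g h, G g -> G h -> fconnect s g h -> g = h].

Lemma root_set_froot : is_root_set [pred x | N x & froot s x == x].
Proof.
have symf : connect_sym (frel s) := fconnect_sym s_inj.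
split=> [g /andP[]//|x Nx|g h /= /andP[_ /eqP g_r] /andP[_ /eqP h_r] gh].
  exists (froot s x); last by rewrite symf connect_root.
  rewrite /= root_root // eqxx andbT.
  rewrite -(iter_findex (connect_root (frel s) x)).
  by elim: (findex _ _ _) => //= i; rewrite Ns.
by rewrite -g_r -h_r; apply/(rootP symf).
Qed.

Lemma sum_root_set (G : pred X) (F : X -> T) : is_root_set G ->
  \sum_(x | N x) F x = \sum_(g | G g) \sum_(t < p) F (iter t s g).
Proof.
have symf : connect_sym (frel s) := fconnect_sym s_inj.
move=> [GN Gex Guniq].
transitivity (\sum_(x | N x) \sum_(g | G g && fconnect s g x) F x).
  apply: eq_bigr => x Nx; have [g Gg gx] := Gex x Nx.
  rewrite (big_pred1 g) // => h /=; apply/andP/eqP => [[Gh hx]|->//].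
  by apply: Guniq => //; apply: connect_trans hx _; rewrite symf.
rewrite (exchange_big_dep G) /=; last by move=> x h _ /andP[].
apply: eq_bigr => g Gg.
transitivity (\sum_(x in orbit s g) F x).
  apply: eq_bigl => x; rewrite Gg /= -fconnect_orbit andb_idl //.
  move=> /iter_findex <-.
  by elim: (findex _ _ _) => /= [|i]; rewrite ?Ns //; apply: GN.
rewrite -big_uniq ?orbit_uniq // /orbit prime_order ?N_free ?GN //.
rewrite (big_nth g) size_traject big_mkord.
by apply: eq_bigr => i _; rewrite nth_traject.
Qed.

Lemma is_weight_iter w x t : is_weight w -> N x ->
  w (iter t s x) = w x + t %[mod p].
Proof.
move=> ww Nx; elim: t => [|t IH]; first by rewrite addn0.
rewrite iterS ww; last by elim: t {IH} => //= t; rewrite Ns.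
by rewrite addnS -addn1 -modnDml IH modnDml addn1.
Qed.

Section NullOrbits.
Variable F : X -> T.
Hypothesis F_orbit : forall x, N x -> \sum_(t < p) F (iter t s x) = 0.

Lemma sum_null : \sum_(x | N x) F x = 0.
Proof.
rewrite (sum_root_set _ root_set_froot) big1 // => g /andP[Ng _].
exact: F_orbit.
Qed.

(** At step [t] of the orbit of [g] the weight is [w g + t] modulo [p]; the constant [w g]
    multiplies a full orbit sum, which is zero. *)
Lemma weighted_sum_root_set (G : pred X) w : is_weight w -> is_root_set G ->
  \sum_(x | N x) F x *+ w x =
  \sum_(g | G g) \sum_(t < p) F (iter t s g) *+ t.
Proof.
move=> ww rG; rewrite (sum_root_set _ rG); apply: eq_bigr => g Gg.
have Ng : N g by case: rG => GN _ _; apply: GN.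
under eq_bigr do rewrite (mulrn_eqmod _ (is_weight_iter _ ww Ng)) mulrnDr.
by rewrite big_split /= sumrMnl F_orbit // mul0rn add0r.
Qed.

Lemma weighted_sum_unique w w' : is_weight w -> is_weight w' ->
  \sum_(x | N x) F x *+ w x = \sum_(x | N x) F x *+ w' x.
Proof.
by move=> ww ww'; rewrite !(@weighted_sum_root_set _ _ _ root_set_froot).
Qed.

End NullOrbits.

(** After reindexing by [s], the coefficient of [F (s x)] is [w (s x) - w x], which is 1 modulo
    [p]. *)
Lemma sum_by_parts (F : X -> T) w : is_weight w ->
  \sum_(x | N x) (F x - F (s x)) *+ w x = \sum_(x | N x) F x.
Proof.
move=> ww; have reix (H : X -> T) : \sum_(x | N x) H x = \sum_(x | N x) H (s x).
  by rewrite (reindex_inj s_inj) /=; apply: eq_bigl => x; rewrite Ns.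
rewrite (eq_bigr (fun x => F x *+ w x - F (s x) *+ w x)); last first.
  by move=> x _; rewrite mulrnBl.
rewrite sumrB (reix (fun x => F x *+ w x)) -sumrB [RHS]reix.
apply: eq_bigr => x Nx.
by rewrite (mulrn_eqmod _ (ww x Nx)) mulrSr addrAC subrr add0r.
Qed.

End Weighted.
End PrimeOrbits.

(** * Words of length [p] under rotation *)

Section Words.
Variables (p : nat) (I : finType).

Definition rotw (g : p.-tuple I) : p.-tuple I := [tuple of rotr 1 g].

Lemma val_iter_rotw t (g : p.-tuple I) : (t <= p)%N ->
  val (iter t rotw g) = rotr t g.
Proof.
elim: t => [|t IH] lt; first by rewrite /rotr subn0 rot_size.
rewrite iterS /= IH ?(ltnW lt) // /rotr size_rot size_tuple.
rewrite rot_add_mod ?size_tuple ?leq_subr //.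
have [e|ne] := eqVneq t.+1 p; last by case: ifP => ?; [lia|congr rot; lia].
have -> : (p - 1 + (p - t) = size g)%N by rewrite size_tuple; lia.
by rewrite size_tuple leqnn e subnn rot0 -{1}(size_tuple g) rot_size.
Qed.

Lemma iter_rotw g : iter p rotw g = g.
Proof.
by apply: val_inj; rewrite val_iter_rotw // /rotr size_tuple subnn rot0.
Qed.

Lemma rotw_fixed g : (0 < p)%N -> (rotw g == g) = (constant g).
Proof.
move=> p_gt0; apply/eqP/idP => [/(congr1 val)/=|/constantP]; last first.
  move=> /(_ (tnth g (Ordinal p_gt0)))[a ga]; apply: val_inj => /=.
  have/all_pred1P : all (pred1 a) (rotr 1 g).
    by rewrite (eq_all_r (mem_rotr 1 g)) ga all_pred1_nseq.
  by rewrite size_rotr -ga.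
case: (val g) => // a l; rewrite {1}lastI rotr1_rcons => -[_].
elim: l a => //= b l IH a [<- e]; rewrite eqxx /=.
by apply: IH.
Qed.
End Words.

Lemma rotw_map (p : nat) (I J : finType) (f : I -> J) (g : p.-tuple I) :
  rotw [tuple of map f g] = [tuple of map f (rotw g)].
Proof. by apply: val_inj; rewrite /= map_rotr. Qed.

Lemma addr_idem_eq0 (V : zmodType) (x : V) : x = x + x -> x = 0.
Proof. by rewrite -{1}[x]addr0 => /addrI. Qed.

(** * Multiadditive functions of lists *)

Section Multiadditive.
Variables (V W : zmodType).

(** Lists of all lengths are allowed, so that fixing the first entry stays within the notion and
    induction on the length works. *)
Definition multiadditive (F : seq V -> W) :=
  forall l1 l2 a b,
    F (l1 ++ (a + b) :: l2) = F (l1 ++ a :: l2) + F (l1 ++ b :: l2).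

Lemma multiadditive_cons F a :
  multiadditive F -> multiadditive (fun l => F (a :: l)).
Proof. by move=> mF l1 l2 b c; rewrite -!cat_cons mF. Qed.

Lemma multiadditive_sum_head F I (r : seq I) (P : pred I) (x : I -> V) l :
  multiadditive F ->
  F ((\sum_(i <- r | P i) x i) :: l) = \sum_(i <- r | P i) F (x i :: l).
Proof.
move=> mF; apply: (big_morph (fun a => F (a :: l))) => [a b|].
  exact: (mF [::]).
by apply: addr_idem_eq0; rewrite -(mF [::]) addr0.
Qed.

(** The letters of [w] are names of classes of indices, with [Q] as membership; choosing one summand
    at each position produces the words that fit the pattern [w]. *)
Lemma multiadditive_expand (I J : finType) (Q : J -> pred I) (x : I -> V)
    m (w : m.-tuple J) F : multiadditive F ->
  F [seq \sum_(i | Q j i) x i | j <- w] =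
  \sum_(g : m.-tuple I | all2 Q w g) F (map x g).
Proof.
elim: m w F => [|m IH] w F mF.
  rewrite (big_pred1 [tuple]) => [|g /=]; first by rewrite [w]tuple0.
  by rewrite [w]tuple0 [g]tuple0; exact: esym (eqxx _).
case/tupleP: w => j w; rewrite /= multiadditive_sum_head //.
rewrite (eq_bigr _ (fun i _ => IH w _ (multiadditive_cons (x i) mF))).
pose h (u : I * m.-tuple I) := [tuple of u.1 :: u.2].
rewrite pair_big_dep /= [RHS](reindex h) //=.
exists (fun g => (thead g, [tuple of behead g])) => [[i g] _|g _] /=.
  by rewrite theadE; congr (_, _); apply: val_inj.
by rewrite /h -tuple_eta.
Qed.
End Multiadditive.

(** * The action of sigma as rotation, and orbit representatives *)

Section SigmaAction.
Variables (p n : nat).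

Lemma tnth_rotw_ordS (g : p.-tuple 'I_n) k : tnth (rotw g) (ordS k) = tnth g k.
Proof.
have x0 := tnth g k; case: k => k lt; rewrite !(tnth_nth x0) /=.
have: size g = p by rewrite size_tuple.
case/lastP: (val g) => [|l a]; first by move=> p0; rewrite -p0 in lt.
rewrite size_rcons rotr1_rcons nth_rcons => p_l.
have [ltk|] := ltnP k (size l); first by rewrite modn_small // -p_l.
rewrite leq_eqVlt ltnNge -ltnS p_l lt orbF => /eqP e.
by rewrite -e eqxx p_l modnn.
Qed.

(** [sigma] inverts the cyclic successor of positions, so each position receives the letter of its
    predecessor. *)
Lemma perm_act_sigma (g : p.-tuple 'I_n) : perm_act (sigma p) g = rotw g.
Proof.
apply: eq_from_tnth => k; rewrite tnth_mktuple -tnth_rotw_ordS; congr tnth.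
by rewrite -[ordS _](permE (@ordS_inj p)) permKV.
Qed.

Lemma perm_act_sigmaX t (g : p.-tuple 'I_n) :
  perm_act (sigma p ^+ t)%g g = iter t (@rotw p 'I_n) g.
Proof.
elim: t => [|t IH].
  by apply: eq_from_tnth => k; rewrite tnth_mktuple perm1.
rewrite iterS -IH -perm_act_sigma expgS.
by apply: eq_from_tnth => k; rewrite !tnth_mktuple permM.
Qed.

Lemma fconnect_perm_act_sigma :
  fconnect (perm_act (n := n) (sigma p)) =2 fconnect (@rotw p 'I_n).
Proof. exact: eq_fconnect perm_act_sigma. Qed.

Lemma fconnect_rotw_sym : connect_sym (frel (@rotw p 'I_n)).
Proof.
apply: fconnect_sym => g h e; rewrite -[g]iter_rotw -[h]iter_rotw.
case: p g h e => [|k] g h e; first by rewrite [g]tuple0 [h]tuple0.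
by rewrite !iterSr e.
Qed.

Lemma equivalence_partition_sigma :
  let D := ~: Delta p n in
  partition (equivalence_partition (fconnect (perm_act (sigma p))) D) D /\
  {in D &, forall x y, (y \in pblock
    (equivalence_partition (fconnect (perm_act (sigma p))) D) x)
    = fconnect (@rotw p 'I_n) x y}.
Proof.
move=> D.
have eqR : {in D & &, equivalence_rel (fconnect (perm_act (sigma p)))}.
  move=> x y z _ _ _; rewrite !fconnect_perm_act_sigma connect0; split=> // xy.
  exact: (same_connect fconnect_rotw_sym xy).
split; first exact: equivalence_partitionP.
move=> x y Dx Dy.
by rewrite pblock_equivalence_partition // fconnect_perm_act_sigma.
Qed.

Lemma sigma_reps_exists : exists G, @sigma_reps p n G.
Proof. by eexists; apply: transversalP equivalence_partition_sigma.1. Qed.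

(** Once blocks are identified with rotation orbits, the single element of [G] in each block gives
    both existence and uniqueness of the representative. *)
Lemma sigma_reps_root_set (G : {set p.-tuple 'I_n}) : sigma_reps G ->
  is_root_set (@rotw p 'I_n) [pred g | rotw g != g] (mem G).
Proof.
case/and3P=> partP /subsetP GD /forall_inP G1.
have [_ blockE] := equivalence_partition_sigma.
have DE g : (g \in ~: Delta p n) = (rotw g != g) by rewrite !inE perm_act_sigma.
set P := equivalence_partition _ _ in partP G1 blockE.
have blockP x : x \in ~: Delta p n -> pblock P x \in P.
  by rewrite -(cover_partition partP); apply: pblock_mem.
split=> [g /GD|x Nx|g h Gg Gh gh] /=; first by rewrite DE.
  have Dx : x \in ~: Delta p n by rewrite DE.
  have /cards1P[g GB] := G1 _ (blockP x Dx).
  have : g \in [set g] by rewrite inE.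
  rewrite -GB inE => /andP[Gg gx]; exists g => //.
  by rewrite fconnect_rotw_sym -blockE //; apply: GD.
have /cards1P[k GB] := G1 _ (blockP g (GD _ Gg)).
have in_k f : f \in G -> fconnect (@rotw p 'I_n) g f -> f = k.
  by move=> Gf gf; apply/set1P; rewrite -GB inE Gf blockE //; apply: GD.
by rewrite (in_k g) ?connect0 // (in_k h).
Qed.
End SigmaAction.

(** * Sums of pure tensors, and maps out of quotient groups *)

Section TensorFacts.
Variables A B : zmodType.

Lemma tensBl (x y : A) (b : B) : tens (x - y) b = tens x b - tens y b.
Proof. by apply/eqP; rewrite eq_sym subr_eq -(tens_biadditive A B).1 subrK. Qed.

Lemma tens0l (b : B) : tens (0 : A) b = 0.
Proof. by have := tensBl 0 0 b; rewrite !subrr. Qed.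

Lemma tensor_sum_pure (x : tensor A B) :
  exists n (a : 'I_n -> A) (b : 'I_n -> B), x = \sum_i tens (a i) (b i).
Proof.
suff [s ->] : exists s : seq (A * B), x = \sum_(u <- s) tens u.1 u.2.
  exists (size s), (fun i => (nth (0, 0) s i).1), (fun i => (nth (0, 0) s i).2).
  by rewrite (big_nth (0, 0)) big_mkord.
elim/tensor_ind: x => [|x y [s ->] [t ->]|a b].
- by exists [::]; rewrite big_nil.
(* A subtracted pure tensor is again pure, with the sign moved into its first factor. *)
- exists (s ++ [seq (- u.1, u.2) | u <- t]); rewrite big_cat big_map -sumrN.
  congr (_ + _); apply: eq_bigr => u _ /=.
  by rewrite -[- u.1]sub0r tensBl tens0l sub0r.
by exists [:: (a, b)]; rewrite big_seq1.
Qed.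
End TensorFacts.

Section QuotientLift.
Variables (V W : zmodType) (S : V -> Prop) (f : {additive V -> W}).
Hypothesis f_S : forall x, S x -> f x = 0.

Lemma in_span_ker x : in_span S x -> f x = 0.
Proof.
by elim=> [y /f_S|| y z _ fy _ fz] //; rewrite ?raddf0 // raddfB fy fz subrr.
Qed.

Definition zquot_lift (q : zquot S) : W := f (repr q).

Lemma zquot_liftE x : zquot_lift (zclass S x) = f x.
Proof.
apply/eqP; rewrite -subr_eq0 -raddfB; apply/eqP/in_span_ker/zclass_eq0.
by rewrite raddfB /= {1}/zclass reprK subrr.
Qed.

Lemma zclass_surj (q : zquot S) : exists x, q = zclass S x.
Proof. by exists (repr q); rewrite /zclass reprK. Qed.

Lemma zquot_lift_zmod_morphism : zmod_morphism zquot_lift.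
Proof.
move=> q q'; have [[x ->] [y ->]] := (zclass_surj q, zclass_surj q').
by rewrite -raddfB !zquot_liftE raddfB.
Qed.

End QuotientLift.

(** * Noncommutative 1-forms and forms attached to words *)

Section Forms.
Variable S : pzRingType.

Lemma b3_tensBl (x y : tensor S S) (c : S) :
  b3 (tens (x - y) c) = b3 (tens x c) - b3 (tens y c).
Proof. by rewrite tensBl raddfB. Qed.

(* The noncommutative 1-forms of S modulo commutators and exact forms; the
   class of a (x) b stands for a db. *)
Definition forms := zquot (fun x : tensor S S => im_b3 x \/ sym_tensor x).
HB.instance Definition _ := GRing.Zmodule.on forms.

Definition to_forms (x : tensor S S) : forms := zclass _ x.
HB.instance Definition _ := GRing.Additive.copy to_forms (zclass _).

Definition form (a b : S) : forms := to_forms (tens a b).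

Lemma form_biadditive : biadditive form.
Proof.
have [tl tr] := tens_biadditive S S.
by split=> [b a a'|a b b'] /=; rewrite /form ?tl ?tr raddfD.
Qed.
Lemma formDl b a a' : form (a + a') b = form a b + form a' b.
Proof. exact: form_biadditive.1. Qed.
Lemma formDr a b b' : form a (b + b') = form a b + form a b'.
Proof. exact: form_biadditive.2. Qed.

Lemma form_sym a b : form a b + form b a = 0.
Proof.
rewrite -raddfD; apply/zclass_eq0/span_gen; right.
by exists a, b.
Qed.

(** The Leibniz rule with [c] moved to the front by a commutator; it is the relation imposed by [b3]
    on a pure tensor. *)
Lemma formM a b c : form a (b * c) = form (a * b) c + form (c * a) b.
Proof.
apply/esym/eqP; rewrite -subr_eq0 addrAC -raddfB -raddfD -b3E.
by apply/eqP/zclass_eq0/span_gen; left; eexists.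
Qed.

Lemma form_1r a : form a 1 = 0.
Proof. by apply: addr_idem_eq0; have := formM a 1 1; rewrite !mul1r mulr1. Qed.

Lemma form_1l a : form 1 a = 0.
Proof. by have := form_sym 1 a; rewrite form_1r addr0. Qed.

Lemma form_prod a (l : seq S) :
  form a (\prod_(x <- l) x) = \sum_(i < size l)
    form ((\prod_(x <- drop i.+1 l) x) * a * \prod_(x <- take i l) x) l`_i.
Proof.
elim: l a => [|b l IH] a; first by rewrite big_nil big_ord0 form_1r.
rewrite big_cons formM IH big_ord_recl /= drop0 big_nil mulr1 addrC.
by congr (_ + _); apply: eq_bigr => i _; rewrite /= big_cons !mulrA.
Qed.

(** The counterpart of [word_tensor] in [forms], for lists of any length. *)
Definition word_form (l : seq S) : forms :=
  form (\prod_(x <- take (size l).-1 l) x) (last 1 l).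

Lemma word_form_rcons l a : word_form (rcons l a) = form (\prod_(x <- l) x) a.
Proof. by rewrite /word_form size_rcons -cats1 take_size_cat // last_cat. Qed.

(* This is d(x_1 ... x_m) = 0. *)
Lemma word_form_rot (l : seq S) : \sum_(i < size l) word_form (rotr i l) = 0.
Proof.
case: l => [|a0 l0]; first by rewrite big_ord0.
(* In reverse order the i-th rotation ends in the letter [i] of [l], so it matches the i-th Leibniz
   term of 1 d(x_1 ... x_m), which is zero. *)
set l := a0 :: l0; rewrite (reindex_inj rev_ord_inj) /=.
rewrite -[RHS](form_1l (\prod_(x <- l) x)) form_prod.
apply: eq_bigr => i _; rewrite /rotr subKn // /rot.
rewrite (take_nth 0) // -rcons_cat word_form_rcons big_cat mulr1 //.
Qed.

Lemma multiadditive_rcons (F : seq S -> forms) :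
  (forall l1 l2 a b c, F (l1 ++ (a + b) :: rcons l2 c) =
      F (l1 ++ a :: rcons l2 c) + F (l1 ++ b :: rcons l2 c)) ->
  (forall l a b, F (rcons l (a + b)) = F (rcons l a) + F (rcons l b)) ->
  multiadditive F.
Proof.
move=> Fi Fl l1 l2 a b; case/lastP: l2 => [|l2 c]; last exact: Fi.
by rewrite !cats1 Fl.
Qed.

Lemma word_form_multiadditive : multiadditive word_form.
Proof.
apply: multiadditive_rcons => [l1 l2 a b c|l a b].
  rewrite -!rcons_cons -!rcons_cat !word_form_rcons !big_cat !big_cons /=.
  by rewrite mulrDl mulrDr formDl.
by rewrite !word_form_rcons formDr.
Qed.

(* [a_1; ...; a_m] is sent to a_1 b a_2 b ... b a_m. *)
Definition interleave (b : S) (l : seq S) : S :=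
  head 0 l * \prod_(x <- behead l) (b * x).

Lemma prodMl_comm (b : S) l :
  b * \prod_(x <- l) (x * b) = (\prod_(x <- l) (b * x)) * b.
Proof.
elim: l => [|a l IH]; first by rewrite !big_nil mulr1 mul1r.
by rewrite !big_cons -!mulrA IH.
Qed.

Lemma interleave_rcons b l a :
  interleave b (rcons l a) = (\prod_(x <- l) (x * b)) * a.
Proof.
case: l => [|c l]; first by rewrite /interleave /= !big_nil mulr1 mul1r.
rewrite /interleave /= big_rcons big_cons /= -!mulrA; congr (_ * _).
by rewrite mulrA -prodMl_comm !mulrA.
Qed.

Lemma interleave_multiadditive b :
  multiadditive (fun l => form (interleave b l) b).
Proof.
apply: multiadditive_rcons => [l1 l2 a a' c|l a a'].
  rewrite -!rcons_cons -!rcons_cat !interleave_rcons !big_cat !big_cons /=.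
  by rewrite !(mulrDl, mulrDr) formDl.
by rewrite !interleave_rcons mulrDr formDl.
Qed.

Lemma prod_nseq (a : S) n : \prod_(x <- nseq n a) x = a ^+ n.
Proof. by elim: n => [|n IH]; rewrite ?big_nil // big_cons IH exprS. Qed.

Lemma interleave_nseq b a n : interleave b (nseq n.+1 a) = (a * b) ^+ n * a.
Proof.
rewrite -addn1 nseqD cats1 interleave_rcons.
by rewrite -(big_map (fun x => x * b) xpredT id) map_nseq prod_nseq.
Qed.

Lemma word_form_nseq a n : word_form (nseq n.+1 a) = form (a ^+ n) a.
Proof. by rewrite -addn1 nseqD cats1 word_form_rcons prod_nseq. Qed.

(** Apply Leibniz to d(ab) and d(ba) for the last letter [a]: the two [da] terms agree by
    [prodMl_comm] and cancel, and the [db] terms are the interleaved words of [l] and of its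
    rotation. The result has the shape needed for [sum_by_parts]. *)
Lemma word_form_swap (b : S) (l : seq S) : l != [::] ->
  word_form [seq a * b | a <- l] - word_form [seq b * a | a <- l] =
  form (interleave b l) b - form (interleave b (rotr 1 l)) b.
Proof.
case/lastP: l => // l a _; rewrite !map_rcons !word_form_rcons rotr1_rcons.
rewrite interleave_rcons !big_map !formM -prodMl_comm opprD addrA addrK.
by rewrite /interleave.
Qed.
End Forms.

(** * Extensions of abelian groups by symmetric 2-cocycles *)

Section CocycleExtension.
Variables (A W : zmodType) (c : A -> A -> W).

Definition symmetric_cocycle :=
  [/\ commutative c, forall x, c x 0 = 0 &
      forall x y z, c x y + c (x + y) z = c y z + c x (y + z)].

Hypothesis cP : symmetric_cocycle.

(** The proof is an argument of the type, so that the twisted group law, whose axioms rest on it,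
    can be declared as an instance. *)
Definition extension of symmetric_cocycle : Type := (A * W)%type.

Let E := extension cP.
Definition ext_add (u v : E) : E := (u.1 + v.1, u.2 + v.2 + c u.1 v.1).
Definition ext_opp (u : E) : E := (- u.1, - u.2 - c u.1 (- u.1)).
Definition ext_zero : E := (0, 0).

Fact ext_addA : associative ext_add.
Proof.
case: cP => _ _ cA u v w; rewrite /ext_add /= addrA; congr (_, _).
rewrite -!addrA; congr (_ + (_ + _)).
by rewrite [RHS]addrCA cA.
Qed.
Fact ext_addC : commutative ext_add.
Proof.
by case: cP => cC _ _ u v; rewrite /ext_add (addrC u.1) (addrC u.2) cC.
Qed.
Fact ext_add0 : left_id ext_zero ext_add.
Proof.
by case: cP => cC c0 _ [a w]; rewrite /ext_add /= !add0r cC c0 addr0.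
Qed.
Fact ext_addN : left_inverse ext_zero ext_opp ext_add.
Proof.
case: cP => cC _ _ [a w]; rewrite /ext_add /= addNr (cC _ a) addrAC subrK.
by rewrite addNr.
Qed.

HB.instance Definition _ := Choice.copy (extension cP) (A * W)%type.
HB.instance Definition _ :=
  GRing.isZmodule.Build (extension cP) ext_addA ext_addC ext_add0 ext_addN.

Lemma ext_addE (u v : extension cP) :
  u + v = (u.1 + v.1, u.2 + v.2 + c u.1 v.1) :> A * W.
Proof. reflexivity. Qed.

End CocycleExtension.

Lemma constant_map_pred (I : Type) (P : pred I) (l : seq I) :
  constant (map P l) = all P l || all (predC P) l.
Proof.
case: l => //= i l; rewrite all_map.
have [Pi|nPi] /= := boolP (P i); rewrite ?orbF.
  by apply: eq_all => j /=; case: (P j).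
by apply: eq_all => j /=; case: (P j).
Qed.

Lemma all2_map_eq (I : eqType) (P P1 : pred I) p (w : p.-tuple bool)
    (g : p.-tuple I) :
  all2 (fun b i => P i && (P1 i == b)) w g =
  all P g && ([tuple of map P1 g] == w).
Proof.
rewrite -val_eqE /=.
elim: p w g => [|p IH] w g; first by rewrite [w]tuple0 [g]tuple0.
case/tupleP: w => b w; case/tupleP: g => i g /=.
by rewrite IH eqseq_cons -!andbA; congr (_ && _); rewrite andbCA.
Qed.

(** * Weighted word sums and the cocycle in characteristic [p] *)

Section CharacteristicP.
Variables (S : pzRingType) (p : nat).
Hypotheses (p_pr : prime p) (S_p : forall x : S, x *+ p = 0).
Let p_gt0 := prime_gt0 p_pr.

Lemma forms_p (t : forms S) : t *+ p = 0.
Proof.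
have [x ->] : exists x, t = to_forms x := zclass_surj t.
elim/tensor_ind: x => [|x y hx hy|a b]; first by rewrite raddf0 mul0rn.
  by rewrite raddfB mulrnBl hx hy subrr.
rewrite -/(form a b).
have form0 : form 0 b = 0.
  by apply: addr_idem_eq0; rewrite -formDl addr0.
have formMn n : form (a *+ n) b = form a b *+ n.
  by elim: n => [|n IH]; rewrite ?mulr0n // !mulrS formDl IH.
by rewrite -formMn S_p.
Qed.

Section Letters.
Variables (I : finType) (x : I -> S).

Lemma word_form_orbit (g : p.-tuple I) :
  \sum_(t < p) word_form (map x (iter t (@rotw p I) g)) = 0.
Proof.
have := word_form_rot (map x g); rewrite size_map size_tuple.
apply: etrans; apply: eq_bigr => t _.
by rewrite val_iter_rotw ?map_rotr // ltnW.
Qed.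

Definition word_sum (P : pred I) : forms S :=
  \sum_(g : p.-tuple I | all P g && (rotw g != g))
    word_form (map x g) *+ weight (@rotw p I) g.

End Letters.

Definition pair_fun (x y : S) (b : bool) := if b then x else y.

Definition cocycle (x y : S) : forms S := word_sum (pair_fun x y) predT.

Lemma rotw_inj (I : finType) : injective (@rotw p I).
Proof. exact/prime_iter_inj/iter_rotw. Qed.

(** A word in [P] lies in [P1], lies in [P2], or is mixed. Mixed words can be weighted through their
    pattern of classes; collecting them by pattern and factoring the letter sums gives the
    cocycle. *)
Lemma word_sumU (I : finType) (x : I -> S) (P P1 P2 : pred I) :
  P =1 predU P1 P2 -> (forall i, P1 i -> ~~ P2 i) ->
  word_sum x P = word_sum x P1 + word_sum x P2 +
    cocycle (\sum_(i | P1 i) x i) (\sum_(i | P2 i) x i).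
Proof.
move=> defP dis; rewrite /word_sum.
pose m (g : p.-tuple I) := [tuple of map P1 g].
have m_rot g : m (rotw g) = rotw (m g) by rewrite rotw_map.
have m_fixed g : (rotw (m g) == m g) = all P1 g || all (predC P1) g.
  by rewrite rotw_fixed //= constant_map_pred.
have all_rot (Q : pred I) (g : p.-tuple I) : all Q (rotw g) = all Q g.
  exact: eq_all_r (mem_rotr 1 g) _.
have P1P i : P1 i -> P i by rewrite defP /= => ->.
have P2P i : P i && ~~ P1 i = P2 i.
  by rewrite defP /=; have := dis i; case: (P1 i) (P2 i) => [|] [|] //= ->.
rewrite (bigID (fun g => rotw (m g) != m g)) /= addrC; congr (_ + _).
  rewrite (bigID (fun g : p.-tuple I => all P1 g)) /=.
  congr (_ + _); apply: eq_bigl => g; rewrite negbK m_fixed.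
    have [a1|_] := boolP (all P1 g); last by rewrite !andbF.
    by rewrite (sub_all P1P a1) !andbT.
  transitivity (all P g && all (predC P1) g && (rotw g != g)); last first.
    by rewrite -all_predI; congr (_ && _); apply: eq_all => i /=; apply: P2P.
  have [a1|_] := boolP (all P1 g); last by rewrite andbT /= andbAC.
  (* As [p > 0], a word has a letter, so it cannot both lie in [P1] and avoid it. *)
  have g0 := mem_tnth (Ordinal p_gt0) g.
  have -> : all (predC P1) g = false.
    by apply/negP => /allP/(_ _ g0); rewrite /= (allP a1 _ g0).
  by rewrite !andbF.
(* [N] selects the mixed words, those whose pattern is moved by rotation. *)
pose N (g : p.-tuple I) := all P g && (rotw (m g) != m g).
have Nfree g : N g -> rotw g != g.
  by case/andP=> _; apply: contra => /eqP e; rewrite -m_rot e.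
rewrite (eq_bigl N) => [|g]; last first.
  by rewrite andbAC; apply: andb_idr => /Nfree.
have NS g : N (rotw g) = N g.
  by rewrite /N all_rot m_rot (inj_eq (@rotw_inj _)).
(* The pattern map commutes with rotation, so the weight of the pattern is also a weight on [N] and
   may replace that of the word. *)
rewrite (@weighted_sum_unique _ _ _ p_pr (@iter_rotw p I) _ forms_p N NS Nfree
  (fun g => word_form (map x g)) _ _ (fun g => weight (@rotw p bool) (m g))).
- rewrite (partition_big m (fun w => rotw w != w)) /= => [|g /andP[]//].
  rewrite /cocycle /word_sum; apply: eq_big => [w|w rw].
    by rewrite all_predT.
  rewrite (eq_bigr (fun g : p.-tuple I =>
    word_form (map x g) *+ weight (@rotw p bool) w)) => [|g /andP[_ /eqP->]//].
  rewrite sumrMnl; congr (_ *+ _).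
  have sums b : pair_fun (\sum_(i | P1 i) x i) (\sum_(i | P2 i) x i) b =
      \sum_(i | P i && (P1 i == b)) x i.
    rewrite /pair_fun.
    case: b; apply: eq_bigl => i; rewrite ?eqb_id ?eqbF_neg ?P2P //.
    by apply/esym/andb_idl/P1P.
  rewrite (eq_map sums).
  rewrite (multiadditive_expand (fun b i => P i && (P1 i == b))); last first.
    exact: word_form_multiadditive.
  apply: eq_bigl => g; rewrite all2_map_eq /N -/(m g).
  by have [->|] := eqVneq (m g) w; rewrite ?rw ?andbT ?andbF.
- by move=> g _; apply: word_form_orbit.
- exact: (weight_is_weight p_pr (@iter_rotw p I) Nfree).
- by move=> g /andP[_ rg]; rewrite m_rot weightS // => w; apply: iter_rotw.
Qed.

Lemma word_sum0 (I : finType) (x : I -> S) : word_sum x pred0 = 0.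
Proof.
rewrite /word_sum big_pred0 // => g; apply/negP => /andP[/allP a0 _].
by have /a0 := mem_tnth (Ordinal p_gt0) g.
Qed.

Lemma word_sum1 (I : finType) (x : I -> S) i : word_sum x (pred1 i) = 0.
Proof.
rewrite /word_sum big_pred0 // => g; apply/negP => /andP[gi /negP[]].
by rewrite rotw_fixed // (all_pred1_constant gi).
Qed.

(** Split the alphabet [bool] with [false] first; words in a single letter are fixed by rotation and
    contribute nothing. *)
Lemma cocycleC x y : cocycle x y = cocycle y x.
Proof.
rewrite {1}/cocycle (@word_sumU _ _ _ (pred1 false) (pred1 true)).
- by rewrite !word_sum1 !big_pred1_eq !add0r.
- by case.
- by case.
Qed.

Lemma cocycle0 x : cocycle x 0 = 0.
Proof.
have := @word_sumU unit (fun=> x) predT predT pred0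
  (fun=> erefl) (fun=> fun=> erefl).
rewrite word_sum0 addr0 big_pred0_eq (big_pred1 tt) => [|[]//].
by rewrite -[LHS]addr0 => /addrI.
Qed.

(** Both sides compute the weighted sum over words in three letters, split once after the second
    letter and once after the first. *)
Lemma cocycleA x y z :
  cocycle x y + cocycle (x + y) z = cocycle y z + cocycle x (y + z).
Proof.
pose u (i : 'I_3) := [:: x; y; z]`_i.
pose i0 : 'I_3 := Ordinal (isT : 0 < 3)%N.
pose i1 : 'I_3 := Ordinal (isT : 1 < 3)%N.
pose i2 : 'I_3 := Ordinal (isT : 2 < 3)%N.
have e12 : \sum_(i | predU (pred1 i1) (pred1 i2) i) u i = y + z.
  by rewrite big_mkcond !big_ord_recl big_ord0 /= add0r addr0.
have e01 : \sum_(i | predU (pred1 i0) (pred1 i1) i) u i = x + y.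
  by rewrite big_mkcond !big_ord_recl big_ord0 /= !addr0.
have ord3P (P : pred 'I_3) : P i0 -> P i1 -> P i2 -> P =1 predT.
  move=> P0 P1 P2 [[|[|[|//]]] lt] /=.
  - by rewrite -P0; congr P; apply: val_inj.
  - by rewrite -P1; congr P; apply: val_inj.
  - by rewrite -P2; congr P; apply: val_inj.
transitivity (word_sum u predT).
  rewrite (@word_sumU _ _ _ (predU (pred1 i0) (pred1 i1)) (pred1 i2)).
  - rewrite (@word_sumU _ u (predU _ _) (pred1 i0) (pred1 i1)) //.
      by rewrite !word_sum1 e01 !big_pred1_eq !add0r addr0.
    by move=> i /eqP->.
  - by move=> i; rewrite [RHS](ord3P (predU _ _)).
  - by move=> i /orP[] /eqP->.
rewrite (@word_sumU _ _ _ (pred1 i0) (predU (pred1 i1) (pred1 i2))).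
- rewrite (@word_sumU _ u (predU _ _) (pred1 i1) (pred1 i2)) //.
    by rewrite !word_sum1 e12 !big_pred1_eq !add0r.
  by move=> i /eqP->.
- by move=> i; rewrite [RHS](ord3P (predU _ _)).
- by move=> i /eqP->.
Qed.

Lemma multiadditive_pair (W : zmodType) (F : seq S -> W) x y :
  multiadditive F ->
  F (nseq p (x + y)) = F (nseq p x) + F (nseq p y) +
    \sum_(g : p.-tuple bool | rotw g != g) F (map (pair_fun x y) g).
Proof.
move=> mF.
(* Every position admits both letters, so the pattern [nseq p true] only fixes the length. *)
have := multiadditive_expand (fun=> predT) (pair_fun x y)
  [tuple of nseq p true] mF.
rewrite /= map_nseq big_bool /= => ->.
rewrite (eq_bigl predT) => [|g]; last first.
  by rewrite all2E size_nseq size_tuple eqxx /= all_predT.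
rewrite (bigID (fun g => rotw g == g)) /=; congr (_ + _).
rewrite (bigD1 [tuple of nseq p true]) /=; last first.
  by rewrite rotw_fixed //= constant_nseq.
rewrite (big_pred1 [tuple of nseq p false]) /= => [|g].
  by rewrite !map_nseq.
rewrite rotw_fixed //; apply/andP/eqP => [[/(constantP true)[b gb] g_t]|->].
  apply: val_inj; rewrite /= gb size_tuple; case: b gb => // gb.
  by case/eqP: g_t; apply: val_inj; rewrite /= gb size_tuple.
rewrite constant_nseq; split=> //; apply/eqP => /(congr1 val) /=.
by case: p p_gt0.
Qed.

Lemma word_form_pow (x : S) : word_form (nseq p x) = form (x ^+ p.-1) x.
Proof. by rewrite -(prednK p_gt0) word_form_nseq. Qed.

(** The mixed words in the expansion cancel orbit by orbit. *)
Lemma pow_formD (x y : S) : form ((x + y) ^+ p.-1) (x + y) =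
  form (x ^+ p.-1) x + form (y ^+ p.-1) y.
Proof.
rewrite -!word_form_pow (multiadditive_pair _ _ (@word_form_multiadditive S)).
rewrite (@sum_null _ _ _ p_pr (@iter_rotw p bool)) ?addr0 //.
  by move=> g; rewrite (inj_eq (@rotw_inj _)).
by move=> g _; apply: word_form_orbit.
Qed.

(** * The leading term of theta and its defect of additivity *)

Definition theta_form (a b : S) := form ((a * b) ^+ p.-1 * a) b.

Lemma theta_form_interleave a b :
  theta_form a b = form (interleave b (nseq p a)) b.
Proof. by rewrite -(prednK p_gt0) interleave_nseq. Qed.

(** Summation by parts turns the mixed words of the expansion into weighted differences
    [A g - A (rotw g)], which [word_form_swap] rewrites as words in [a * b], [a' * b] minus words in
    [b * a], [b * a']. *)
Lemma theta_formDl a a' b : theta_form (a + a') b =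
  theta_form a b + theta_form a' b +
  (cocycle (a * b) (a' * b) - cocycle (b * a) (b * a')).
Proof.
rewrite !theta_form_interleave.
rewrite (multiadditive_pair _ _ (@interleave_multiadditive S b)); congr (_ + _).
pose A (g : p.-tuple bool) := form (interleave b (map (pair_fun a a') g)) b.
have Ns g : (rotw (rotw g) != rotw g) = (rotw g != g :> p.-tuple bool).
  by rewrite (inj_eq (@rotw_inj _)).
rewrite -(@sum_by_parts _ _ _ p_pr (@iter_rotw p bool) _ forms_p _ Ns
  A _ (weight_is_weight p_pr (@iter_rotw p bool) (fun g Ng => Ng))).
rewrite /cocycle /word_sum -sumrB; apply: eq_big => g.
  by rewrite all_predT.
move=> Ng; rewrite -mulrnBl; congr (_ *+ _).
rewrite /A /= map_rotr -word_form_swap; last first.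
  by rewrite -size_eq0 size_map size_tuple -lt0n.
by rewrite -!map_comp; congr (word_form _ - word_form _); apply: eq_map; case.
Qed.

Lemma mul_pow_shift (a b : S) n : b * (a * b) ^+ n = (b * a) ^+ n * b.
Proof. by elim: n => [|n IH]; rewrite ?mulr1 ?mul1r // !exprS -!mulrA IH. Qed.

(** Leibniz for d(ab). With [pow_formD] it transfers the additivity law from the first argument to
    the second. *)
Lemma theta_form_swap a b :
  theta_form a b + theta_form b a = form ((a * b) ^+ p.-1) (a * b).
Proof.
by rewrite formM mul_pow_shift.
Qed.

Lemma theta_formDr a b b' : theta_form a (b + b') =
  theta_form a b + theta_form a b' +
  (cocycle (a * b) (a * b') - cocycle (b * a) (b' * a)).
Proof.
have swap c : theta_form a c = form ((a * c) ^+ p.-1) (a * c) - theta_form c a.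
  by rewrite -theta_form_swap addrK.
rewrite !swap mulrDr pow_formD theta_formDl.
by rewrite opprD (opprD (theta_form b a)) addrA [X in X + _ = _]addrACA opprB.
Qed.

(** * The boundary on forms *)

Definition form_b : forms S -> S := zquot_lift (@b2 S).

Lemma b2_forms x : im_b3 x \/ sym_tensor x -> b2 x = 0 :> S.
Proof. by case; [apply: im_b3_ker | apply: sym_tensor_ker]. Qed.

HB.instance Definition _ := GRing.isZmodMorphism.Build _ _ form_b
  (zquot_lift_zmod_morphism b2_forms).

Lemma form_bE (a b : S) : form_b (form a b) = a * b - b * a.
Proof. exact: etrans (zquot_liftE b2_forms _) (b2E _ _). Qed.

Lemma form_b_to_forms x : form_b (to_forms x) = b2 x.
Proof. exact: (zquot_liftE b2_forms). Qed.

Lemma prod_multiadditive : multiadditive (fun l : seq S => \prod_(x <- l) x).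
Proof. by move=> l1 l2 a b; rewrite !big_cat !big_cons /= mulrDl mulrDr. Qed.

(** The boundary of a word form is the product of the word minus that of its rotation, so summation
    by parts leaves the mixed words of [(x + y) ^+ p]. *)
Lemma form_b_cocycle x y :
  form_b (cocycle x y) = (x + y) ^+ p - (x ^+ p + y ^+ p).
Proof.
rewrite -3!(prod_nseq _ p) (multiadditive_pair _ _ prod_multiadditive).
rewrite addrAC subrr add0r.
have Ns g : (rotw (rotw g) != rotw g) = (rotw g != g :> p.-tuple bool).
  by rewrite (inj_eq (@rotw_inj _)).
rewrite -(@sum_by_parts _ _ _ p_pr (@iter_rotw p bool) _ S_p _ Ns
  _ _ (weight_is_weight p_pr (@iter_rotw p bool) (fun g Ng => Ng))).
rewrite raddf_sum; apply: eq_big => g; first by rewrite all_predT.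
move=> Ng; rewrite raddfMn; congr (_ *+ _) => /=.
rewrite map_rotr; case/lastP: (map _ _) => [|l a].
  by rewrite /word_form form_bE /= mulr1 mul1r.
by rewrite rotr1_rcons word_form_rcons form_bE big_rcons big_cons.
Qed.

Lemma form_b_theta_form a b :
  form_b (theta_form a b) = (a * b) ^+ p - (b * a) ^+ p.
Proof.
by rewrite form_bE -mulrA -exprSr mulrA mul_pow_shift -mulrA -exprSr prednK.
Qed.

(** * Theta as a homomorphism into the extension *)

Definition cocycle2 (u v : S * S) : forms S :=
  cocycle u.1 v.1 - cocycle u.2 v.2.

Lemma cocycle2P : symmetric_cocycle cocycle2.
Proof.
split=> [u v|u|u v w]; rewrite /cocycle2 /=.
- by rewrite cocycleC (cocycleC u.2).
- by rewrite !cocycle0 subrr.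
by rewrite addrACA [RHS]addrACA -!opprD !cocycleA.
Qed.

Let E := extension cocycle2P.

(** The base coordinates are the products at which [theta_formDl] and [theta_formDr] evaluate the
    cocycle. *)
Definition theta_ext (a b : S) : E := ((a * b, b * a), theta_form a b).

Lemma theta_ext_biadditive : biadditive theta_ext.
Proof.
split=> [b a a'|a b b'] /=; rewrite /theta_ext.
  by rewrite theta_formDl mulrDl mulrDr.
by rewrite theta_formDr mulrDl mulrDr.
Qed.

Definition theta_lift : tensor S S -> E := tensor_lift theta_ext.
HB.instance Definition _ := GRing.isZmodMorphism.Build _ _ theta_lift
  (tensor_lift_zmod_morphism theta_ext_biadditive).

Lemma theta_liftE a b : theta_lift (tens a b) = theta_ext a b.
Proof. exact/tensor_liftE/theta_ext_biadditive. Qed.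

(** Negation in the extension is twisted by the cocycle, so differences are handled through this
    sum. *)
Lemma theta_liftB x y : theta_lift x = theta_lift (x - y) + theta_lift y.
Proof. by rewrite raddfB subrK. Qed.

Lemma theta_lift_b2 x : (theta_lift x).1.1 = (theta_lift x).1.2 + b2 x.
Proof.
elim/tensor_ind: x => [|x y|a b]; first by rewrite !raddf0 addr0.
  rewrite (theta_liftB x y) (raddfB (@b2 S)) ext_addE /= => hx hy.
  by apply: (addIr (theta_lift y).1.1); rewrite hx hy addrACA subrK.
by rewrite theta_liftE b2E addrC subrK.
Qed.

Definition theta_part (x : tensor S S) : forms S := (theta_lift x).2.

(** By [theta_lift_b2] the two base coordinates of a cycle coincide, so the halves of [cocycle2]
    cancel. *)
Lemma theta_partB x y : b2 x = 0 -> b2 y = 0 ->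
  theta_part (x - y) = theta_part x - theta_part y.
Proof.
move=> x0 y0; have xy0 : b2 (x - y) = 0 by rewrite raddfB /= x0 y0 subrr.
rewrite /theta_part [theta_lift x](theta_liftB x y) ext_addE /= /cocycle2.
rewrite (theta_lift_b2 (x - y)) (theta_lift_b2 y) xy0 y0 !addr0.
by rewrite subrr addr0 addrK.
Qed.

(** The tensors ab (x) r + ra (x) b and a (x) br differ by a boundary; by Leibniz their theta terms
    agree, which leaves only cocycle terms to compare. *)
Lemma theta_part_b3 y : theta_part (b3 y) = 0.
Proof.
have b20 z : b2 (b3 z) = 0 :> S by apply: im_b3_ker; exists z.
elim/tensor_ind: y => [|y z hy hz|x r].
- by rewrite /theta_part !raddf0.
- by rewrite (raddfB (@b3 S)) /= theta_partB // hy hz subrr.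
elim/tensor_ind: x => [|y z hy hz|a b].
- by rewrite tens0l /theta_part !raddf0.
- by rewrite b3_tensBl theta_partB // hy hz subrr.
have := theta_liftB (tens (a * b) r + tens (r * a) b) (tens a (b * r)).
rewrite addrAC -b3E raddfD !theta_liftE !ext_addE /= => -[_].
(* The boundary is a cycle, so its base coordinates are equal; the second one is read off as
   [r * a * b]. *)
rewrite /theta_part /cocycle2 /= (theta_lift_b2 (b3 _)) b20 addr0.
rewrite !theta_liftE /= mulrA [b * (r * a)]mulrA => /addIr <-.
have -> : theta_form a (b * r) = theta_form (a * b) r + theta_form (r * a) b.
  by rewrite /theta_form formM !mulrA mul_pow_shift !mulrA.
rewrite [a * (b * r)]mulrA (cocycleC _ (r * a * b)) => e.
by move/addIr: e; rewrite -{1}[_ + theta_form _ b]add0r => /addIr.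
Qed.

(** The boundary of the cocycle is the failure of the p-th power to be additive, so both sides obey
    the same addition law. On cycles the right side vanishes, which puts theta in the kernel of the
    boundary. *)
Lemma form_b_theta_part x :
  form_b (theta_part x) = (theta_lift x).1.1 ^+ p - (theta_lift x).1.2 ^+ p.
Proof.
(* The addition law gives the image of [x] from those of [x - y] and [y]; this identity solves for
   the term of [x - y]. *)
have cancel (s u u' v v' U U' : S) :
    s + (v - v') + ((U - (u + v)) - (U' - (u' + v'))) = U - U' -> s = u - u'.
  have -> : (U - (u + v)) - (U' - (u' + v')) = U - U' - ((u - u') + (v - v')).
    rewrite [u - u' + _]addrACA -opprD opprB [u' + v' - _]addrC addrACA.
    by rewrite opprB [- (u + v) + _]addrC.
  rewrite addrCA -[RHS]addr0 => /addrI/eqP.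
  by rewrite subr_eq0 => /eqP/addIr.
rewrite /theta_part; elim/tensor_ind: x => [|x y|a b].
- by rewrite raddf0 raddf0 subrr.
- rewrite (theta_liftB x y) ext_addE /=.
  move: (theta_lift (x - y)) (theta_lift y) => u v.
  rewrite /cocycle2 raddfD raddfD raddfB /= => hx hy.
  by move: hx; rewrite hy !form_b_cocycle; apply: cancel.
by rewrite theta_liftE form_b_theta_form.
Qed.

(** Adding a letter contributes one cocycle with the sum of the earlier ones, which is how
    [word_sum] grows by [word_sumU]. *)
Lemma theta_lift_sum (n : nat) (alpha beta : 'I_n -> S) (r : seq 'I_n) :
  uniq r ->
  \sum_(i <- r) theta_ext (alpha i) (beta i) =
  ((\sum_(i <- r) alpha i * beta i, \sum_(i <- r) beta i * alpha i),
   \sum_(i <- r) theta_form (alpha i) (beta i) +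
   (word_sum (fun i => alpha i * beta i) (mem r) -
    word_sum (fun i => beta i * alpha i) (mem r))) :> S * S * forms S.
Proof.
elim: r => [|i r IH] /=.
  by rewrite !big_nil !word_sum0 subrr addr0.
case/andP=> ir ur; rewrite !big_cons ext_addE IH //=; congr (_, _).
have wU (x : 'I_n -> S) : word_sum x (mem (i :: r)) =
    word_sum x (mem r) + cocycle (x i) (\sum_(j <- r) x j).
  rewrite (@word_sumU _ _ _ (pred1 i) (mem r)).
  - by rewrite word_sum1 add0r big_pred1_eq -big_uniq.
  - by move=> j; rewrite /= inE.
  - by move=> j /eqP->.
rewrite !wU /cocycle2 /= opprD [X in _ = _ + X]addrACA.
by rewrite !addrA.
Qed.

Lemma to_forms_word_tensor n (alpha beta : 'I_n -> S) (g : p.-tuple 'I_n) :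
  to_forms (word_tensor alpha beta g) =
  word_form [seq alpha i * beta i | i <- g].
Proof. by rewrite /word_form size_map size_tuple. Qed.

Lemma word_sum_root_set n (x : 'I_n -> S) (Gamma : {set p.-tuple 'I_n}) :
  sigma_reps Gamma ->
  word_sum x predT = \sum_(g in Gamma) \sum_(1 <= t < p)
    word_form (map x (perm_act (sigma p ^+ t)%g g)) *+ t.
Proof.
move=> /sigma_reps_root_set rG.
have Ns g : (rotw (rotw g) != rotw g) = (rotw g != g :> p.-tuple 'I_n).
  by rewrite (inj_eq (@rotw_inj _)).
rewrite /word_sum; under eq_bigl do rewrite all_predT.
rewrite (@weighted_sum_root_set _ _ _ p_pr (@iter_rotw p 'I_n) _ forms_p _ Ns
  _ (fun g => word_form (map x g)) _ _ _
  (weight_is_weight p_pr (@iter_rotw p 'I_n) (fun g Ng => Ng)) rG) //;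
  last by move=> g _; apply: word_form_orbit.
apply: eq_bigr => g _.
pose F t := word_form (map x (iter t (@rotw p 'I_n) g)) *+ t.
(* The term [t = 0] has weight zero and drops out. *)
rewrite -(big_mkord xpredT F) {}/F big_ltn // mulr0n add0r.
apply: eq_bigr => t _.
by rewrite perm_act_sigmaX.
Qed.

(** The right side sees only the tensor, hence the formula depends neither on its presentation nor
    on [Gamma]. *)
Lemma to_forms_theta_expr n (alpha beta : 'I_n -> S)
    (Gamma : {set p.-tuple 'I_n}) :
  sigma_reps Gamma ->
  to_forms (theta_expr alpha beta Gamma) =
  theta_part (\sum_i tens (alpha i) (beta i)).
Proof.
move=> GP; rewrite /theta_part (raddf_sum theta_lift).
rewrite (eq_bigr _ (fun i _ => theta_liftE (alpha i) (beta i))).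
rewrite theta_lift_sum ?index_enum_uniq //=.
rewrite /theta_expr raddfD raddf_sum; congr (_ + _).
have allP x : word_sum x (mem (index_enum 'I_n)) = word_sum x predT.
  rewrite /word_sum; apply: eq_bigl => g; congr (_ && _).
  by apply: eq_all => i; rewrite /= mem_index_enum.
rewrite !allP !(word_sum_root_set _ GP) -sumrB raddf_sum; apply: eq_bigr => g _.
rewrite -sumrB raddf_sum; apply: eq_bigr => t _.
by rewrite raddfB /= 2!(raddfMn (@to_forms S)) /= !to_forms_word_tensor.
Qed.

End CharacteristicP.

(** * HC_1 as the kernel of the boundary on forms *)

Section CyclicHomologyOfForms.
Variable S : pzRingType.

Definition HC1_form_gen (x : kernel (@b2 S)) :=
  im_b3 (val x) \/ sym_tensor (val x).

Definition ker_to_forms (x : kernel (@b2 S)) : forms S := to_forms (val x).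

Fact ker_to_forms_zmod_morphism : zmod_morphism ker_to_forms.
Proof. by move=> x y; rewrite /ker_to_forms !raddfB. Qed.
HB.instance Definition _ := GRing.isZmodMorphism.Build _ _ ker_to_forms
  ker_to_forms_zmod_morphism.

Lemma ker_to_forms_gen x : HC1_form_gen x -> ker_to_forms x = 0.
Proof. by move=> gx; apply/zclass_eq0/span_gen. Qed.

Definition HC1_to_forms : HC1 S -> forms S := zquot_lift ker_to_forms.
HB.instance Definition _ := GRing.isZmodMorphism.Build _ _ HC1_to_forms
  (zquot_lift_zmod_morphism ker_to_forms_gen).

Lemma HC1_to_formsE x : HC1_to_forms (HC1_class x) = to_forms (val x).
Proof. exact: (zquot_liftE ker_to_forms_gen). Qed.

(** All generators lie in the kernel of [b2], so a combination of them in the tensor product lifts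
    term by term to the kernel. *)
Lemma HC1_to_forms_inj : injective HC1_to_forms.
Proof.
apply: raddf_inj => h; have [x ->] := zclass_surj h.
rewrite [LHS]HC1_to_formsE => /zclass_eq0 x0; apply/zclass_eq0.
suff [k kx gk] :
    exists2 k : kernel (@b2 S), val k = val x & in_span HC1_form_gen k.
  by rewrite -(val_inj kx).
elim: x0 => [y gy||y z _ [k <- gk] _ [l <- gl]].
- have y0 : y \in ker_pred (@b2 S) by apply/eqP/b2_forms.
  by exists (Kernel y0) => //; apply: span_gen.
- by exists 0 => //; apply: span_0.
by exists (k - l); [rewrite raddfB | apply: span_B].
Qed.

Lemma HC1_to_forms_surj (t : forms S) :
  form_b t = 0 -> exists h, HC1_to_forms h = t.
Proof.
have [x ->] := zclass_surj t; rewrite form_b_to_forms => /eqP x0.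
exists (HC1_class (Kernel (x0 : x \in ker_pred (@b2 S)))).
by rewrite HC1_to_formsE.
Qed.

End CyclicHomologyOfForms.

(** * Compatibility with reduction modulo [p] *)

Section ReductionTensor.
Variables (R : pzRingType) (p : nat).
Notation S := (quot_p R p).

Lemma quot_p_mulrn (x : S) : x *+ p = 0.
Proof.
have [y ->] : exists y, x = red_p p y by exists (repr x); rewrite /red_p reprK.
rewrite -raddfMn -[RHS](raddf0 (@red_p R p)); apply/red_p_eq; exists y.
by rewrite subr0.
Qed.

Lemma red_tensorE (a b : R) :
  red_tensor p (tens a b) = tens (red_p p a) (red_p p b).
Proof. exact: tensor_mapE. Qed.

Lemma b2_red_tensor (x : tensor R R) : b2 (red_tensor p x) = red_p p (b2 x).
Proof.
elim/tensor_ind: x => [|x y hx hy|a b]; first by rewrite !raddf0.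
  by rewrite !raddfB /= hx hy.
by rewrite red_tensorE !b2E raddfB /= !rmorphM.
Qed.

Lemma b3_red_tensor (x : tensor (tensor R R) R) :
  red_tensor p (b3 x) = b3 (tensor_map (@red_tensor R p) (@red_p R p) x).
Proof.
elim/tensor_ind: x => [|x y hx hy|x c]; first by rewrite !raddf0.
  by rewrite !raddfB /= hx hy.
rewrite tensor_mapE /=; elim/tensor_ind: x => [|x y hx hy|a b].
- by rewrite raddf0 !tens0l !raddf0.
- rewrite b3_tensBl.
  have -> : red_tensor p (x - y) = red_tensor p x - red_tensor p y.
    exact: raddfB.
  transitivity (red_tensor p (b3 (tens x c)) - red_tensor p (b3 (tens y c))).
    exact: raddfB.
  by rewrite hx hy; apply/esym/b3_tensBl.
by rewrite red_tensorE !b3E raddfD raddfB /= !red_tensorE !rmorphM.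
Qed.

Lemma red_tensor_theta_expr n (alpha beta : 'I_n -> R)
    (Gamma : {set p.-tuple 'I_n}) :
  red_tensor p (theta_expr alpha beta Gamma) =
  theta_expr (fun i => red_p p (alpha i)) (fun i => red_p p (beta i)) Gamma.
Proof.
have wordE (a b : 'I_n -> R) g : red_tensor p (word_tensor a b g) =
    word_tensor (fun i => red_p p (a i)) (fun i => red_p p (b i)) g.
  have mapE : [seq red_p p x | x <- [seq a i * b i | i <- g]] =
      [seq red_p p (a i) * red_p p (b i) | i <- g].
    by rewrite -map_comp; apply: eq_map => i /=; rewrite rmorphM.
  rewrite /word_tensor red_tensorE -mapE -[in RHS]map_take; congr tens.
    by rewrite rmorph_prod [RHS]big_map.
  by rewrite -[X in _ = last X _](rmorph1 (@red_p R p)) last_map.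
rewrite /theta_expr raddfD !raddf_sum; congr (_ + _); apply: eq_bigr => i _.
  by rewrite /= red_tensorE rmorphM rmorphXn rmorphM.
by rewrite raddf_sum; apply: eq_bigr => t _; rewrite raddfB !raddfMn /= !wordE.
Qed.

End ReductionTensor.

Theorem theorem2p3 (R : pzRingType) (p : nat) (p_pr : prime p) :
  exists theta : {additive H1 R -> HC1 (quot_p R p)},
    given_by_theta_formula theta /\
    (forall theta' : H1 R -> HC1 (quot_p R p),
       given_by_theta_formula theta' -> theta' =1 theta).
Proof.
have S_p := @quot_p_mulrn R p.
pose Th (z : kernel (@b2 R)) := theta_part p_pr S_p (red_tensor p (val z)).
have b2_red (z : kernel (@b2 R)) : b2 (red_tensor p (val z)) = 0.
  by case: z => x /= /eqP x0; rewrite b2_red_tensor [b2 x]x0 raddf0.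
have ThB : zmod_morphism Th.
  move=> x y; rewrite /Th -(theta_partB p_pr S_p (b2_red x) (b2_red y)).
  by rewrite !raddfB.
pose Thm : {additive _ -> _} :=
  HB.pack Th (GRing.isZmodMorphism.Build _ _ _ ThB).
have Th_b3 (z : kernel (@b2 R)) : im_b3 (val z) -> Thm z = 0.
  by case=> y zy; rewrite /= /Th zy b3_red_tensor theta_part_b3.
have form_b_Th z : form_b (Th z) = 0.
  by rewrite form_b_theta_part theta_lift_b2 b2_red addr0 subrr.
(* The values have zero boundary, so they come from HC_1; injectivity of [HC1_to_forms] then makes
   the chosen preimages additive. *)
have /choice[theta thetaE] (h : H1 R) :
    exists k : HC1 (quot_p R p), HC1_to_forms k = zquot_lift Thm h.
  by apply: HC1_to_forms_surj; apply: form_b_Th.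
have theta_add : zmod_morphism theta.
  move=> x y; apply: HC1_to_forms_inj; rewrite [RHS]raddfB /= !thetaE.
  exact: (zquot_lift_zmod_morphism Th_b3).
pose theta_a : {additive _ -> _} :=
  HB.pack theta (GRing.isZmodMorphism.Build _ _ _ theta_add).
have theta_ok : given_by_theta_formula theta_a.
  move=> n alpha beta Gamma z zE GP.
  have redE := red_tensor_theta_expr alpha beta Gamma.
  have wE : to_forms (red_tensor p (theta_expr alpha beta Gamma)) = Th z.
    rewrite redE (to_forms_theta_expr p_pr S_p _ _ GP) /Th zE raddf_sum.
    by congr (theta_part _ _ _); apply: eq_bigr => i _; rewrite /= red_tensorE.
  (* The reduced expression is a cycle because its class is [Th z], whose boundary is zero. *)
  have w0 : red_tensor p (theta_expr alpha beta Gamma) \in ker_pred (@b2 _).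
    apply/eqP; apply: etrans (esym (form_b_to_forms _)) _.
    by rewrite wE form_b_Th.
  exists (Kernel w0) => //; apply: HC1_to_forms_inj.
  by rewrite HC1_to_formsE thetaE (zquot_liftE Th_b3) wE.
exists theta_a; split=> // theta' theta'_ok h.
have [z ->] := zclass_surj h.
(* Uniqueness: each cycle has a presentation and representatives exist, so the formula fixes every
   value. *)
have [n [alpha [beta zE]]] := tensor_sum_pure (val z).
have [Gamma GP] := sigma_reps_exists p n.
have [w wE ->] := theta'_ok _ _ _ _ _ zE GP.
have [w' w'E ->] := theta_ok _ _ _ _ _ zE GP.
by congr HC1_class; apply: val_inj; rewrite wE w'E.
Qed.
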